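(* Let $0<s<1$, $p>1$, and let $v$ be a positive and radially decreasing solution of $$(-\Delta)^sv-v^p=0\ \text{ in }B_1\setminus\{0\},\qquad v=0\ \text{ in }\mathbb R^N\setminus B_1.$$ Then there exists a constant $c_{17}=c_{17}(N,p,s)>0$ such that $$v(x)\le c_{17}|x|^{-\frac{2s}{p-1}}\qquad\text{for all }x\in B_{\frac12}\setminus\{0\}.$$
   Context: $B_r$ is the open ball of radius $r$ centred at $0$ in $\mathbb R^N$. $(-\Delta)^sv(x)=c_{N,s}\lim_{\epsilon\to0}\int_{|x-y|>\epsilon}\frac{v(x)-v(y)}{|x-y|^{N+2s}}dy$ with the standard positive normalization constant $c_{N,s}$. A solution is a function $v\in C^2(B_1\setminus\{0\})\cap L^1(\mathbb R^N,(1+|x|)^{-N-2s}dx)$ satisfying the equation pointwise; ''positive'' refers to $B_1\setminus\{0\}$, and radially decreasing means $v$ is radially symmetric and decreasing with respect to $|x|$. *)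

(* Defs.v *)
From HB Require Import structures.
From mathcomp Require Import all_boot all_order all_algebra.
From mathcomp Require Import all_classical all_reals all_analysis.

Set Implicit Arguments.
Unset Strict Implicit.
Unset Printing Implicit Defensive.

Import Order.TTheory GRing.Theory Num.Theory.
Import numFieldNormedType.Exports.

Local Open Scope classical_set_scope.
Local Open Scope ring_scope.

(* R^N is 'rV[R]_N, with the product sigma-algebra of the Borel sigma-algebra
   of R, as the library does for n.-tuple. *)

Definition measure_rV_display : measure_display.
Proof. by constructor. Qed.

Definition rV_coord (R : realType) (n : nat) :
  'I_n -> 'rV[R]_n -> measurableTypeR R := fun i x => x ord0 i.

Lemma rV_measurable0 (R : realType) n : g_sigma_preimage (@rV_coord R n) set0.
Proof. exact: sigma_algebra0. Qed.

Lemma rV_measurableC (R : realType) n A :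
  g_sigma_preimage (@rV_coord R n) A -> g_sigma_preimage (@rV_coord R n) (~` A).
Proof. exact: sigma_algebraC. Qed.

Lemma rV_measurable_bigcup (R : realType) n (F : (set 'rV[R]_n)^nat) :
  (forall i, g_sigma_preimage (@rV_coord R n) (F i)) ->
  g_sigma_preimage (@rV_coord R n) (\bigcup_i F i).
Proof. exact: sigma_algebra_bigcup. Qed.

HB.instance Definition _ (R : realType) (n : nat) :=
  @isMeasurable.Build measure_rV_display 'rV[R]_n
    (g_sigma_preimage (@rV_coord R n))
    (@rV_measurable0 R n) (@rV_measurableC R n) (@rV_measurable_bigcup R n).

Lemma measurable_rV_coord (R : realType) (n : nat) (i : 'I_n) :
  measurable_fun [set: 'rV[R]_n] (@rV_coord R n i).
Proof.
move=> _ Y mY; rewrite setTI; apply: sub_sigma_algebra => /=.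
rewrite -bigcup_seq/=; exists i => /=; first by rewrite mem_index_enum.
by exists Y => //; rewrite setTI.
Qed.

Lemma measurable_fun_rVP (R : realType) d (T : measurableType d) n
    (f : T -> 'rV[R]_n) :
  (forall i, measurable_fun [set: T] (@rV_coord R n i \o f)) ->
  measurable_fun [set: T] f.
Proof.
move=> mf _ A mA; rewrite setTI.
have : preimage_set_system setT f (g_sigma_preimage (@rV_coord R n)) `<=`
    measurable.
  rewrite -g_sigma_preimage_comp.
  apply: smallest_sub; first exact: sigma_algebra_measurable.
  rewrite -bigcup_seq; apply: bigcup_sub => i _.
  by move=> _ [B mB <-]; exact: mf.
by apply; exists A => //; rewrite setTI.
Qed.

Definition rV_cons (R : realType) (n : nat)
  (p : measurableTypeR R * 'rV[R]_n) : 'rV[R]_n.+1 :=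
  row_mx (const_mx (p.1 : R) : 'rV[R]_1) p.2.

Lemma rV_cons0 (R : realType) n (p : measurableTypeR R * 'rV[R]_n) :
  rV_cons p ord0 ord0 = p.1.
Proof. by rewrite mxE; case: splitP => // j _; rewrite mxE. Qed.

Lemma rV_consS (R : realType) n (p : measurableTypeR R * 'rV[R]_n) i :
  rV_cons p ord0 (lift ord0 i) = p.2 ord0 i.
Proof.
rewrite mxE; case: splitP => [[[|//] ?] //|j /= ij].
by congr (p.2 ord0 _); apply/val_inj/succn_inj.
Qed.

Lemma measurable_rV_cons (R : realType) n : measurable_fun setT (@rV_cons R n).
Proof.
apply: measurable_fun_rVP => i; have [j ->|->] := unliftP ord0 i.
  rewrite (_ : _ \o _ = @rV_coord R n j \o snd).
    exact: measurableT_comp (@measurable_rV_coord R n j) measurable_snd.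
  by apply/funext => p /=; rewrite /rV_coord rV_consS.
rewrite (_ : _ \o _ = fst); first exact: measurable_fst.
by apply/funext => p /=; rewrite /rV_coord rV_cons0.
Qed.

Definition rV_uncons (R : realType) (n : nat) (x : 'rV[R]_n.+1) :
    measurableTypeR R * 'rV[R]_n :=
  (x ord0 ord0, \row_i x ord0 (lift ord0 i)).

Lemma rV_consK (R : realType) n : cancel (@rV_cons R n) (@rV_uncons R n).
Proof.
move=> p; apply: injective_projections => /=; first exact: rV_cons0.
by apply/rowP => i; rewrite mxE rV_consS.
Qed.

Lemma measurable_rV_uncons (R : realType) n :
  measurable_fun setT (@rV_uncons R n).
Proof.
apply: measurable_fun_pair; first exact: (@measurable_rV_coord R n.+1 ord0).
apply: measurable_fun_rVP => i.
rewrite (_ : _ \o _ = @rV_coord R n.+1 (lift ord0 i)).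
  exact: measurable_rV_coord.
by apply/funext => x /=; rewrite /rV_coord mxE.
Qed.

Definition lebesgue_rV_cons (R : realType) (n : nat)
    (mu : {sigma_finite_measure set 'rV[R]_n -> \bar R}) :
    set 'rV[R]_n.+1 -> \bar R :=
  pushforward (@lebesgue_measure R \x mu)%E (@rV_cons R n).

Lemma lebesgue_rV_cons0 (R : realType) n
    (mu : {sigma_finite_measure set 'rV[R]_n -> \bar R}) :
  lebesgue_rV_cons mu set0 = 0%E.
Proof. by rewrite /lebesgue_rV_cons /pushforward preimage_set0 measure0. Qed.

Lemma lebesgue_rV_cons_ge0 (R : realType) n
    (mu : {sigma_finite_measure set 'rV[R]_n -> \bar R}) A :
  (0 <= lebesgue_rV_cons mu A)%E.
Proof. by rewrite /lebesgue_rV_cons /pushforward measure_ge0. Qed.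

Lemma lebesgue_rV_cons_sigma_additive (R : realType) n
    (mu : {sigma_finite_measure set 'rV[R]_n -> \bar R}) :
  semi_sigma_additive (lebesgue_rV_cons mu).
Proof.
pose g := @rV_cons R n; have mg : measurable_fun setT g.
  exact: measurable_rV_cons.
move=> F mF tF mUF; rewrite /lebesgue_rV_cons /pushforward preimage_bigcup.
apply: measure_semi_sigma_additive.
- by move=> k; rewrite -[X in measurable X]setTI; exact: mg.
- apply/trivIsetP => /= i j _ _ ij; rewrite -preimage_setI.
  by move/trivIsetP : tF => /(_ _ _ _ _ ij) ->//; rewrite preimage_set0.
- by rewrite -preimage_bigcup -[X in measurable X]setTI; exact: mg.
Qed.

HB.instance Definition _ (R : realType) (n : nat)
    (mu : {sigma_finite_measure set 'rV[R]_n -> \bar R}) :=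
  isMeasure.Build _ _ _ (lebesgue_rV_cons mu) (lebesgue_rV_cons0 mu)
    (lebesgue_rV_cons_ge0 mu) (@lebesgue_rV_cons_sigma_additive R n mu).

Lemma lebesgue_rV_cons_sigma_finite (R : realType) n
    (mu : {sigma_finite_measure set 'rV[R]_n -> \bar R}) :
  sigma_finite setT (lebesgue_rV_cons mu).
Proof.
have /sigma_finiteP[F [TF ndF Foo]] := sigma_finiteT (@lebesgue_measure R).
have /sigma_finiteP[G [TG ndG Goo]] := sigma_finiteT mu.
exists (fun k => @rV_uncons R n @^-1` (F k `*` G k)).
  rewrite -preimage_bigcup (_ : \bigcup_k _ = setT) ?preimage_setT//.
  rewrite -setXTT TF TG predeqE => -[x y]; split.
    by move=> [k _ []/= ? ?]; split; exists k.
  move=> [/= [k _ Fkx] [l _ Gly]]; exists (maxn k l) => //; split.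
  - by move: x Fkx; exact/subsetPset/ndF/leq_maxl.
  - by move: y Gly; exact/subsetPset/ndG/leq_maxr.
move=> k; have [mF Fk] := Foo k; have [mG Gk] := Goo k; split.
  rewrite -[X in measurable X]setTI; apply: measurable_rV_uncons => //.
  exact: measurableX.
rewrite /lebesgue_rV_cons /pushforward -comp_preimage.
rewrite (_ : _ \o _ = id); last by apply/funext => p /=; rewrite rV_consK.
by rewrite preimage_id product_measure1E// lte_mul_pinfty// ge0_fin_numE.
Qed.

HB.instance Definition _ (R : realType) (n : nat)
    (mu : {sigma_finite_measure set 'rV[R]_n -> \bar R}) :=
  Measure_isSigmaFinite.Build _ _ _ (lebesgue_rV_cons mu)
    (@lebesgue_rV_cons_sigma_finite R n mu).

(* Lebesgue measure on R^n, as the n-fold product of Lebesgue measure on R. *)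
Fixpoint lebesgue_rV (R : realType) (n : nat) :
    {sigma_finite_measure set 'rV[R]_n -> \bar R} :=
  match n with
  | 0 => \d_(0 : 'rV[R]_0)
  | m.+1 => lebesgue_rV_cons (lebesgue_rV R m)
  end.

Lemma measurable_rV_box (R : realType) (n : nat)
    (A : 'I_n -> set (measurableTypeR R)) : (forall i, measurable (A i)) ->
  measurable [set x : 'rV[R]_n | forall i, A i (x ord0 i)].
Proof.
move=> mA; rewrite (_ : mkset _ =
    \big[setI/setT]_(i < n) (@rV_coord R n i @^-1` A i)).
  apply: bigsetI_measurable => i _.
  by rewrite -[X in measurable X]setTI; exact: measurable_rV_coord.
rewrite -bigcap_seq; apply/seteqP; split => [x /= Ax i _|x Ax i]; first exact: Ax.
by apply: Ax; rewrite /= mem_index_enum.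
Qed.

Lemma lebesgue_rV_box (R : realType) (n : nat)
    (A : 'I_n -> set (measurableTypeR R)) : (forall i, measurable (A i)) ->
  lebesgue_rV R n [set x | forall i, A i (x ord0 i)] =
  (\prod_(i < n) lebesgue_measure (A i))%E.
Proof.
elim: n A => [|n IHn] A mA.
  by rewrite big_ord0 /= diracE mem_set//= => -[].
rewrite big_ord_recl -IHn//=.
rewrite -product_measure1E//; last first.
  exact: (@measurable_rV_box R n (fun i => A (lift ord0 i))).
rewrite /lebesgue_rV_cons /pushforward; congr ((_ \x _)%E _).
apply/seteqP; split => [p /= Ap|p /= [A0 Ap] i].
  by split=> [|i]; [have := Ap ord0; rewrite rV_cons0|
                    have := Ap (lift ord0 i); rewrite rV_consS].
by have [j ->|->] := unliftP ord0 i; rewrite ?rV_cons0 ?rV_consS.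
Qed.

(* The norm `|x| of 'rV[R]_N in the library is the sup norm. *)
Definition enorm (R : realType) (N : nat) (x : 'rV[R]_N) : R :=
  Num.sqrt (\sum_(i < N) x ord0 i ^+ 2).

Definition eball (R : realType) (N : nat) (r : R) : set 'rV[R]_N :=
  [set x | enorm x < r].

Definition punctured_eball (R : realType) (N : nat) (r : R) : set 'rV[R]_N :=
  [set x | eball r x /\ x != 0].

(* All partial derivatives up to order k exist and are continuous on the open
   set O. The sup norm induces the Euclidean topology, so continuity and
   partial derivatives are the usual ones. *)
Fixpoint Ck_on (R : realType) (N k : nat) (O : set 'rV[R]_N)
    (f : 'rV[R]_N -> R) : Prop :=
  (forall x, O x -> {for x, continuous f}) /\
  match k with
  | 0 => True
  | j.+1 => forall i : 'I_N,
      (forall x, O x -> derivable f x (delta_mx ord0 i)) /\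
      Ck_on j O ('D_(delta_mx ord0 i) f)
  end.

Definition gamma_fun (R : realType) (z : R) : R :=
  \int[@lebesgue_measure R]_(t in `]0, +oo[) (t `^ (z - 1) * expR (- t)).

(* Equal to (\int (1 - cos z_1) / |z|^(N + 2s) dz)^-1; with this constant
   (-Delta)^s has Fourier symbol |xi|^(2s). *)
Definition fracLap_cst (R : realType) (N : nat) (s : R) : R :=
  2 `^ (2 * s) * s * gamma_fun (N%:R / 2 + s) /
  (pi `^ (N%:R / 2) * gamma_fun (1 - s)).

Definition fracLap_trunc (R : realType) (N : nat) (s : R) (v : 'rV[R]_N -> R)
    (x : 'rV[R]_N) (e : R) : R :=
  \int[lebesgue_rV R N]_(y in [set y | e < enorm (x - y)])
    ((v x - v y) / enorm (x - y) `^ (N%:R + 2 * s)).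

(* Meaningful when the limit exists, which is required in [is_solution]. *)
Definition fracLap (R : realType) (N : nat) (s : R) (v : 'rV[R]_N -> R)
    (x : 'rV[R]_N) : R :=
  fracLap_cst N s * lim (fracLap_trunc s v x e @[e --> 0^'+]).

(* (-Delta)^s v - v^p = 0 in B_1 \ {0}, v = 0 outside B_1. The value of v at
   the origin is arbitrary. Powers `^ are used for nonnegative v only. *)
Record is_solution (R : realType) (N : nat) (s p : R) (v : 'rV[R]_N -> R) :
    Prop := IsSolution {
  sol_C2 : Ck_on 2 (punctured_eball 1) v ;
  sol_L1 : (lebesgue_rV R N).-integrable setT
    (fun x => (v x * (1 + enorm x) `^ (- (N%:R + 2 * s)))%:E) ;
  sol_cvg : forall x, punctured_eball 1 x ->
    cvg (fracLap_trunc s v x e @[e --> 0^'+]) ;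
  sol_eq : forall x, punctured_eball 1 x -> fracLap s v x - v x `^ p = 0 ;
  sol_ext : forall x, ~ eball 1 x -> v x = 0 }.

(* Decreasing in the wide sense. *)
Definition radially_decreasing (R : realType) (N : nat) (v : 'rV[R]_N -> R) :
    Prop :=
  (forall x y, x != 0 -> y != 0 -> enorm x = enorm y -> v x = v y) /\
  (forall x y, x != 0 -> enorm x < enorm y -> v y <= v x).

(* Main.v *)
(* Fix x with |x| = r, put M = v(x) and w = (3/4) x. On a ball B_a(z) avoiding
   the origin, slide a paraboloid cap t (1 - |y - z|^2 / a^2)_+ with t > v(z)
   below v until it touches v at some point y. The cap is semiconvex, and the
   linear part of its expansion at y integrates to 0 against the even kernel, so
   the equation at y gives v(y)^p <= c (C t a^(-2s) - G), where G is the gain due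
   to far regions on which v is large.
   With z = w and a = r/4, the point y lies in B_r, where v >= M by monotonicity:
   M^p <= C r^(-2s) v(w). With z = x and a = r/4, positivity of v(y)^p bounds the
   gain from B_(r/8), where v >= v(w), by the loss: v(w) <= C M. Together,
   M^(p-1) <= C r^(-2s). *)
Require Import Defs.
From mathcomp Require Import all_boot all_order all_algebra.
From mathcomp Require Import all_classical all_reals all_analysis.
From mathcomp Require Import measurable_realfun ring lra.

Set Implicit Arguments.
Unset Strict Implicit.
Unset Printing Implicit Defensive.

Import Order.TTheory GRing.Theory Num.Theory.
Import numFieldNormedType.Exports.

Local Open Scope classical_set_scope.
Local Open Scope ring_scope.

(** * The Euclidean norm *)

Definition dotr (R : realType) (N : nat) (x y : 'rV[R]_N) : R :=
  \sum_(i < N) x ord0 i * y ord0 i.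

Section euclidean_norm.
Context {R : realType} {N : nat}.
Implicit Types (x y z : 'rV[R]_N) (a : R).

Lemma enorm_ge0 x : 0 <= enorm x.
Proof. exact: sqrtr_ge0. Qed.

Lemma sqr_enorm x : enorm x ^+ 2 = \sum_(i < N) x ord0 i ^+ 2.
Proof. by rewrite sqr_sqrtr// sumr_ge0// => i _; exact: sqr_ge0. Qed.

Lemma enorm0 : enorm (0 : 'rV[R]_N) = 0.
Proof. by rewrite /enorm big1 ?sqrtr0// => i _; rewrite mxE expr0n. Qed.

Lemma enormN x : enorm (- x) = enorm x.
Proof. by congr Num.sqrt; apply: eq_bigr => i _; rewrite mxE sqrrN. Qed.

Lemma enormBC x y : enorm (x - y) = enorm (y - x).
Proof. by rewrite -opprB enormN. Qed.

Lemma enormZ a x : enorm (a *: x) = `|a| * enorm x.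
Proof.
rewrite -sqrtr_sqr -sqrtrM ?sqr_ge0// mulr_sumr; congr Num.sqrt.
by apply: eq_bigr => i _; rewrite mxE exprMn.
Qed.

Lemma ler_coord_enorm x i : `|x ord0 i| <= enorm x.
Proof.
rewrite -sqrtr_sqr ler_wsqrtr// (bigD1 i)//= lerDl sumr_ge0// => j _.
exact: sqr_ge0.
Qed.

Lemma enorm_eq0 x : (enorm x == 0) = (x == 0).
Proof.
apply/eqP/eqP => [x0|->]; last exact: enorm0.
apply/rowP => i; rewrite mxE; apply/normr0_eq0/le_anti.
by rewrite normr_ge0 andbT -x0 ler_coord_enorm.
Qed.

Lemma enorm_gt0 x : (0 < enorm x) = (x != 0).
Proof. by rewrite lt_def enorm_ge0 andbT enorm_eq0. Qed.

(** The factor [N], cruder than its square root, is enough to fit a cube into a ball. *)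
Lemma enorm_le_coord x a : 0 <= a -> (forall i, `|x ord0 i| <= a) ->
  enorm x <= N%:R * a.
Proof.
move=> a0 xa; rewrite -ler_sqr ?nnegrE ?mulr_ge0 ?enorm_ge0// sqr_enorm.
apply: (@le_trans _ _ (\sum_(i < N) a ^+ 2)).
  by apply: ler_sum => i _; rewrite -real_normK ?num_real// ler_sqr ?nnegrE.
rewrite sumr_const card_ord exprMn -[leLHS]mulr_natl.
apply: ler_wpM2r; first exact: sqr_ge0.
by rewrite -natrX ler_nat; case: (N) => // n; rewrite leq_pmull.
Qed.

Lemma sqr_enormD x y :
  enorm (x + y) ^+ 2 = enorm x ^+ 2 + 2 * dotr x y + enorm y ^+ 2.
Proof.
rewrite !sqr_enorm mulr_sumr -!big_split/=; apply: eq_bigr => i _.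
by rewrite mxE; ring.
Qed.

Lemma dotrN x y : dotr (- x) y = - dotr x y.
Proof.
by rewrite -sumrN; apply: eq_bigr => i _; rewrite mxE mulNr.
Qed.

Lemma dotrC x y : dotr x y = dotr y x.
Proof. by apply: eq_bigr => i _; rewrite mulrC. Qed.

Lemma dotrZ a x y : dotr (a *: x) y = a * dotr x y.
Proof. by rewrite mulr_sumr; apply: eq_bigr => i _; rewrite mxE mulrA. Qed.

(** Cauchy-Schwarz: for nonzero vectors, the squared norm of [|y| x - |x| y] is nonnegative and
    equals [2 |x| |y| (|x| |y| - x.y)]. *)
Lemma dotr_le_enorm x y : dotr x y <= enorm x * enorm y.
Proof.
have [->|x0] := eqVneq x 0.
  by rewrite enorm0 mul0r /dotr big1// => i _; rewrite mxE mul0r.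
have [->|y0] := eqVneq y 0.
  by rewrite enorm0 mulr0 /dotr big1// => i _; rewrite mxE mulr0.
have := sqr_ge0 (enorm (enorm y *: x + - (enorm x *: y))).
rewrite sqr_enormD enormN !enormZ !ger0_norm ?enorm_ge0//.
rewrite dotrZ dotrC dotrN dotrZ dotrC.
move: x0 y0; rewrite -!enorm_gt0 => x0 y0 h.
have {}h : 0 <= 2 * (enorm x * enorm y) * (enorm x * enorm y - dotr x y).
  by apply: le_trans h _; lra.
by rewrite -subr_ge0 -(pmulr_rge0 _ (_ : 0 < 2 * (enorm x * enorm y))) ?mulr_gt0.
Qed.

Lemma ler_enormD x y : enorm (x + y) <= enorm x + enorm y.
Proof.
rewrite -ler_sqr ?nnegrE ?addr_ge0 ?enorm_ge0// sqr_enormD sqrrD.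
by have := dotr_le_enorm x y; lra.
Qed.

Lemma abs_dotr_le_enorm x y : `|dotr x y| <= enorm x * enorm y.
Proof.
by rewrite ler_norml dotr_le_enorm andbT lerNl -dotrN -(enormN x) dotr_le_enorm.
Qed.

Lemma ler_enormB x y : enorm (x - y) <= enorm x + enorm y.
Proof. by rewrite -(enormN y) ler_enormD. Qed.

Lemma lerB_enormB x y : enorm x - enorm y <= enorm (x - y).
Proof. by rewrite lerBlDr -{1}(subrK y x) ler_enormD. Qed.

Lemma enorm_continuous : continuous (@enorm R N).
Proof.
have cS : continuous (fun y : 'rV[R]_N => \sum_i y ord0 i ^+ 2).
  apply: continuous_big => [|i _]; first exact: add_continuous.
  move=> x; apply: (@continuous_comp _ _ _
    (fun y : 'rV[R]_N => y ord0 i) (fun t : R => t ^+ 2)).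
    exact: coord_continuous.
  exact: exprn_continuous.
by move=> x; apply: continuous_comp; [exact: cS|exact: sqrt_continuous].
Qed.

(** Heine-Borel: coordinates are bounded by the Euclidean norm, so the set is bounded in the sup
    norm; it is closed by continuity of [enorm]. *)
Lemma closed_eball_compact z a : compact [set y | enorm (y - z) <= a].
Proof.
apply: bounded_closed_compact.
  exists (a + enorm z); split; first exact: num_real.
  move=> M aM y/= ya; rewrite [leLHS]mx_normrE; apply/bigmax_leP; split => /=.
    rewrite (le_trans _ (ltW aM))// addr_ge0 ?enorm_ge0//.
    exact: le_trans (enorm_ge0 _) ya.
  move=> [i j] _ /=; rewrite ord1 (le_trans (ler_coord_enorm _ _))//.
  have := lerB_enormB y z; lra.
apply: (@closed_comp _ _ (fun y => enorm (y - z)) [set t | t <= a]).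
  move=> y _; apply: (@continuous_comp _ _ _ (fun y => y - z) (@enorm R N)).
    apply: continuousB => //; exact: cst_continuous.
  exact: enorm_continuous.
exact: closed_le.
Qed.

Lemma measurable_enorm : measurable_fun [set: 'rV[R]_N] (@enorm R N).
Proof.
apply: (measurableT_comp (continuous_measurable_fun (@sqrt_continuous R))).
apply: measurable_sum => i; apply: measurable_funX.
exact: measurable_rV_coord.
Qed.

Lemma measurable_rV_affine a x :
  measurable_fun [set: 'rV[R]_N] (fun y : 'rV[R]_N => x + a *: y).
Proof.
apply: measurable_fun_rVP => i.
rewrite [X in measurable_fun _ X](_ : _ = fun y => x ord0 i + a * rV_coord i y).
  apply: measurable_funD => //; apply: measurable_funM => //.
  exact: measurable_rV_coord.
by apply/funext => y; rewrite /rV_coord/= !mxE.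
Qed.

Lemma measurable_enormB x :
  measurable_fun [set: 'rV[R]_N] (fun y => enorm (x - y)).
Proof.
rewrite (_ : (fun _ => _) = @enorm R N \o (fun y => x + (-1) *: y)).
  by apply: measurableT_comp; [exact: measurable_enorm|exact: measurable_rV_affine].
by apply/funext => y /=; rewrite scaleN1r.
Qed.

Lemma measurable_dotrB x y :
  measurable_fun [set: 'rV[R]_N] (fun h => dotr x (h - y)).
Proof.
apply: measurable_sum => i; apply: measurable_funM => //.
rewrite [X in measurable_fun _ X](_ : _ = fun h => rV_coord i h - y ord0 i).
  by apply: measurable_funB => //; exact: measurable_rV_coord.
by apply/funext => h; rewrite /rV_coord !mxE.
Qed.

End euclidean_norm.

(** * Lebesgue measure on R^n *)

Section lebesgue_rV.
Context {R : realType}.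

Lemma measurable_enorm_le N (x : 'rV[R]_N) r :
  measurable [set y | enorm (x - y) <= r].
Proof.
rewrite (_ : mkset _ = (fun y => enorm (x - y)) @^-1` `]-oo, r]%classic).
  rewrite -[X in measurable X]setTI; exact: measurable_enormB.
by apply/seteqP; split => y /=; rewrite in_itv.
Qed.

Lemma measurable_enorm_gt N (x : 'rV[R]_N) r :
  measurable [set y | r < enorm (x - y)].
Proof.
rewrite (_ : mkset _ = ~` [set y | enorm (x - y) <= r]).
  by apply: measurableC; exact: measurable_enorm_le.
by apply/seteqP; split => y /=; rewrite ltNge => /negP.
Qed.

Lemma measurable_cube N (x : 'rV[R]_N) r :
  measurable [set y : 'rV[R]_N | forall i, `|x ord0 i - y ord0 i| <= r].
Proof.
rewrite [X in measurable X](_ : _ = [set y : 'rV[R]_N | forall i,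
    `[x ord0 i - r, x ord0 i + r]%classic (y ord0 i)]).
  exact: (measurable_rV_box (A := fun i => `[x ord0 i - r, x ord0 i + r]%classic)).
by apply/seteqP; split => y /= h i; move: (h i); rewrite /= in_itv/= ler_distlC.
Qed.

Lemma lebesgue_rV_cube N (x : 'rV[R]_N) r : 0 <= r ->
  lebesgue_rV R N [set y | forall i, `|x ord0 i - y ord0 i| <= r] =
  ((2 * r) ^+ N)%:E.
Proof.
move=> r0; rewrite [X in lebesgue_rV R N X](_ : _ = [set y : 'rV[R]_N | forall i,
    `[x ord0 i - r, x ord0 i + r]%classic (y ord0 i)]); last first.
  by apply/seteqP; split => y /= h i; move: (h i); rewrite /= in_itv/= ler_distlC.
rewrite (lebesgue_rV_box (A := fun i => `[x ord0 i - r, x ord0 i + r]%classic))//.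
rewrite (eq_bigr (fun=> (2 * r)%:E)) => [|i _].
  by rewrite prodEFin prodr_const card_ord.
rewrite lebesgue_measure_itv/= lte_fin; case: ifPn => h.
  by rewrite -EFinD; congr EFin; lra.
by congr EFin; move: h; rewrite -leNgt; lra.
Qed.

(** The ball lies in the cube of half side [r]. Volumes of balls are only compared with cubes, which
    costs constants depending on [N]. *)
Lemma lebesgue_rV_enorm_le N (x : 'rV[R]_N) r : 0 <= r ->
  (lebesgue_rV R N [set y | (enorm (x - y) <= r)%R] <= ((2 * r) ^+ N)%:E)%E.
Proof.
move=> r0; rewrite -(lebesgue_rV_cube x r0); apply: le_measure; rewrite ?inE.
- exact: measurable_enorm_le.
- exact: measurable_cube.
- move=> y /= + i; apply: le_trans.
  by have := ler_coord_enorm (x - y) i; rewrite !mxE.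
Qed.

Lemma lebesgue_rV_enorm_ge N (x : 'rV[R]_N) r : 0 <= r ->
  (((2 * r) ^+ N)%:E <= lebesgue_rV R N [set y | (enorm (x - y) <= N%:R * r)%R])%E.
Proof.
move=> r0; rewrite -(lebesgue_rV_cube x r0); apply: le_measure; rewrite ?inE.
- exact: measurable_cube.
- exact: measurable_enorm_le.
- by move=> y /= h; apply: enorm_le_coord => // i; rewrite !mxE.
Qed.

(** A point is a closed ball of radius 0, of measure at most [0 ^+ N]. This is what allows the
    origin, where the value of a solution is arbitrary, to be discarded from integrals. *)
Lemma lebesgue_rV_set1 N (x : 'rV[R]_N) : (0 < N)%N ->
  measurable [set x] /\ lebesgue_rV R N [set x] = 0%E.
Proof.
move=> N0; have -> : [set x] = [set y | enorm (x - y) <= 0].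
  apply/seteqP; split => y /= => [->|]; first by rewrite subrr enorm0.
  by rewrite le_eqVlt ltNge enorm_ge0 orbF enorm_eq0 subr_eq0 => /eqP.
split; first exact: measurable_enorm_le.
apply/eqP; rewrite eq_le measure_ge0 andbT.
by rewrite (le_trans (lebesgue_rV_enorm_le _ _))// mulr0 expr0n gtn_eqF.
Qed.

(** The pushforward by the reflection gives each half-open interval its length, and this
    characterizes Lebesgue measure. *)
Lemma lebesgue_measure_reflect (c : R) (A : set (measurableTypeR R)) :
  measurable A ->
  lebesgue_measure ((fun t : measurableTypeR R => (c - t : measurableTypeR R)) @^-1` A) =
  lebesgue_measure A.
Proof.
move=> mA; pose f (t : measurableTypeR R) : measurableTypeR R := c - t.
have mf : measurable_fun setT f by apply: measurable_funB.
suff h X : ocitv X -> lebesgue_measure X = pushforward lebesgue_measure f X.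
  rewrite [RHS](_ : _ = pushforward lebesgue_measure f A)//.
  exact: (lebesgue_measure_unique (mu := pushforward lebesgue_measure f)).
move=> [[a b] /= _ <-]; rewrite /pushforward.
rewrite (_ : f @^-1` _ = `[c - b, c - a[%classic).
  rewrite !lebesgue_measure_itv/= !lte_fin ltrD2l ltrN2.
  by case: ifPn => // _; rewrite -!EFinD; congr EFin; lra.
by apply/seteqP; split => t; rewrite /f/= !in_itv/=; lra.
Qed.

(** Induction on the dimension: through [rV_cons] the reflection acts separately on the first
    coordinate and on the others, so its pushforward agrees with the product measure on
    rectangles. *)
Lemma lebesgue_rV_reflect N (c : 'rV[R]_N) (A : set 'rV[R]_N) :
  measurable A ->
  lebesgue_rV R N ((fun y => c - y) @^-1` A) = lebesgue_rV R N A.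
Proof.
elim: N c A => [|N IHN] c A mA.
  by congr (lebesgue_rV R 0 _); apply/seteqP; split => y /=;
    rewrite (_ : c - y = y)//; apply/rowP => -[].
pose T (p : measurableTypeR R * 'rV[R]_N) : measurableTypeR R * 'rV[R]_N :=
  ((c ord0 ord0 - p.1 : R), \row_i c ord0 (lift ord0 i) - p.2).
have mT : measurable_fun setT T.
  apply: measurable_fun_pair.
    by apply: measurable_funB => //; exact: measurable_fst.
  rewrite (_ : (fun _ => _) =
      (fun y => \row_i c ord0 (lift ord0 i) + (-1) *: y) \o snd).
    apply: measurableT_comp; [exact: measurable_rV_affine|exact: measurable_snd].
  by apply/funext => p /=; rewrite scaleN1r.
have mB : measurable (@rV_cons R N @^-1` A).
  by rewrite -[X in measurable X]setTI; exact: measurable_rV_cons.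
rewrite /= /lebesgue_rV_cons /pushforward.
rewrite (_ : _ @^-1` _ = T @^-1` (@rV_cons R N @^-1` A)); last first.
  apply/seteqP; split => p /=; rewrite (_ : c - _ = rV_cons (T p))//;
    apply/rowP => i; rewrite !mxE; case: splitP => j;
    by rewrite ?ord1 => ij; rewrite !mxE; congr (c ord0 _ + _);
      apply/val_inj; rewrite /= ij.
suff h X Y : measurable X -> measurable Y ->
    pushforward (@lebesgue_measure R \x lebesgue_rV R N)%E T (X `*` Y) =
    (lebesgue_measure X * lebesgue_rV R N Y)%E.
  rewrite [RHS](_ : _ = pushforward (@lebesgue_measure R \x lebesgue_rV R N)%E T
    (@rV_cons R N @^-1` A))//.
  exact: (product_measure_unique
    (m' := pushforward (@lebesgue_measure R \x lebesgue_rV R N)%E T)).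
move=> mX mY; rewrite /pushforward.
rewrite (_ : T @^-1` _ =
    ((fun t : measurableTypeR R =>
      (c ord0 ord0 - t : measurableTypeR R)) @^-1` X) `*`
    ((fun y => \row_i c ord0 (lift ord0 i) - y) @^-1` Y))//.
rewrite product_measure1E.
- by congr (_ * _)%E; [exact: lebesgue_measure_reflect|exact: IHN].
- by rewrite -[X in measurable X]setTI; apply: measurable_funB.
- rewrite -[X in measurable X]setTI.
  have := @measurable_rV_affine R N (-1) (\row_i c ord0 (lift ord0 i)) measurableT Y mY.
  by under [X in X @^-1` _]eq_fun do rewrite scaleN1r.
Qed.

End lebesgue_rV.

(** * The singular kernel *)

Section kernel.
Context {R : realType}.

Lemma nneseries_geometric (c q : R) : 0 <= q -> q < 1 ->
  (\sum_(k <oo) (c * q ^+ k)%:E = (c / (1 - q))%:E)%E.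
Proof.
move=> q0 q1; apply/cvg_lim => //.
rewrite (_ : (fun n => _) = EFin \o series (geometric c q)); last first.
  by apply/funext => n /=; rewrite sumEFin.
by apply: cvg_EFin; [near=> n|apply: cvg_geometric_series; rewrite ger0_norm].
Unshelve. all: by end_near. Qed.

(** The exponent is the binary logarithm of the integer part of [u]; it will index the dyadic
    annulus containing a point. *)
Lemma exists_dyadic (u : R) : 1 <= u -> exists k, 2 ^+ k <= u < 2 ^+ k.+1.
Proof.
move=> u1; have u0 : 0 <= u by apply: le_trans u1.
have tu1 : (0 < Num.truncn u)%N by rewrite truncn_gt0.
exists (trunc_log 2 (Num.truncn u)); apply/andP; split.
  apply: (@le_trans _ _ (Num.truncn u)%:R); last by rewrite truncn_le.
  by rewrite -natrX ler_nat trunc_logP.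
apply: (@lt_le_trans _ _ (Num.truncn u).+1%:R); first exact: truncnS_gt.
by rewrite -natrX ler_nat trunc_log_ltn.
Qed.

(** On [D], [f] is at most the sum over [k] of [m k] times the indicator of the ball of radius
    [r k]. Integrate termwise and enclose each ball in a cube of side [2 * r k]. *)
Lemma integral_le_cover N (x : 'rV[R]_N) (D : set 'rV[R]_N)
    (f : 'rV[R]_N -> R) (r m : nat -> R) :
  measurable D -> measurable_fun D f -> (forall y, D y -> 0 <= f y) ->
  (forall k, 0 <= r k) -> (forall k, 0 <= m k) ->
  (forall y, D y -> exists k, enorm (x - y) <= r k /\ f y <= m k) ->
  (\int[lebesgue_rV R N]_(y in D) (f y)%:E <=
    \sum_(k <oo) (m k * (2 * r k) ^+ N)%:E)%E.
Proof.
move=> mD mf f0 r0 m0 fm.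
pose B k := [set y | enorm (x - y) <= r k].
have mB k : measurable (B k) by exact: measurable_enorm_le.
have mg k : measurable_fun D (fun y => (m k * \1_(B k) y)%:E).
  by apply/measurable_EFinP/measurable_funM.
have g0 k y : (0 <= (m k * \1_(B k) y)%:E)%E by rewrite lee_fin mulr_ge0.
apply: (@le_trans _ _ (\int[lebesgue_rV R N]_(y in D)
    \sum_(k <oo) (m k * \1_(B k) y)%:E)%E).
  apply: ge0_le_integral => //.
  - exact/measurable_EFinP.
  - by apply: ge0_emeasurable_sum.
  - move=> y Dy; have [k [yk fk]] := fm y Dy.
    (* The first [k.+1] terms already contain the one of index [k], and the others are
       nonnegative. *)
    apply: le_trans (nneseries_lim_ge k.+1 _) => //.
    rewrite sumEFin lee_fin big_nat_recr//=.
    rewrite (le_trans fk)// indicE mem_set// mulr1 lerDr sumr_ge0// => i _.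
    by rewrite -lee_fin.
rewrite integral_nneseries//; apply: lee_nneseries => [k _ _|k _].
  exact: integral_ge0.
under eq_integral do rewrite EFinM.
rewrite ge0_integralZl_EFin//; last exact/measurable_EFinP/measurable_indic.
rewrite integral_indic// EFinM lee_wpmul2l ?lee_fin//.
apply: le_trans (lebesgue_rV_enorm_le x (r0 k)).
apply: le_measure; rewrite ?inE.
- exact: measurableI.
- exact: mB.
- exact: subIsetl.
Qed.

Definition fracker N (s : R) (x y : 'rV[R]_N) : R :=
  (enorm (x - y) `^ (N%:R + 2 * s))^-1.

Lemma fracker_ge0 N s (x y : 'rV[R]_N) : 0 <= fracker s x y.
Proof. by rewrite invr_ge0 powR_ge0. Qed.

Lemma measurable_fracker N s (x : 'rV[R]_N) : measurable_fun setT (fracker s x).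
Proof.
rewrite (_ : fracker s x = @powR R ^~ (- (N%:R + 2 * s)) \o (fun y => enorm (x - y))).
  apply: measurableT_comp; [exact: measurable_powR|exact: measurable_enormB].
by apply/funext => y /=; rewrite powRN.
Qed.
End kernel.

(** * Dyadic bounds for the kernel far from and near its singularity *)

Section kernel_bounds.
Context {R : realType} (N : nat) (s : R).
Hypotheses (s0 : 0 < s) (s1 : s < 1).

Local Notation dyad := (2 `^ (2 * s) : R).

Let powR2_gt1 (t : R) : 0 < t -> 1 < 2 `^ t :> R.
Proof.
move=> t0; have := @gt0_ltr_powR R t t0 1 2.
by rewrite !nnegrE ler01 ler0n ltr1n powR1; apply.
Qed.

(** From [0 < s]: the far series, of ratio [dyad^-1], converges. *)
Let dyad_gt1 : 1 < dyad.
Proof. by rewrite powR2_gt1// mulr_gt0. Qed.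

(** From [s < 1]: the near series, of ratio [dyad / 4], converges. *)
Let dyad_lt4 : dyad < 4.
Proof.
have t0 : 0 < 2 - 2 * s by move: s1 => ?; lra.
have := powR2_gt1 t0.
rewrite powRB ?pnatr_eq0 ?implybT// powR_mulrn// ltr_pdivlMr ?powR_gt0// mul1r.
by lra.
Qed.

Let powRXn (x t : R) k : 0 <= x -> (x ^+ k) `^ t = (x `^ t) ^+ k.
Proof. by move=> x0; rewrite -!powR_mulrn ?powR_ge0// powRAC. Qed.

(** For [b] the inner radius of a dyadic annulus, the ball of radius [2 * b] is enclosed in a cube
    of volume [(4 * b) ^+ N], which cancels the factor [b ^+ N] of the kernel. *)
Let kernel_cube (b : R) : 0 < b ->
  (b `^ (N%:R + 2 * s))^-1 * (4 * b) ^+ N = 4 ^+ N * (b `^ (2 * s))^-1.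
Proof.
move=> b0; rewrite powRD; last by rewrite (gt_eqF b0) implybT.
rewrite powR_mulrn ?ltW// exprMn.
have u0 : b ^+ N != 0 by rewrite expf_neq0// gt_eqF.
have w0 : b `^ (2 * s) != 0 by rewrite gt_eqF// powR_gt0.
by field; rewrite u0 w0.
Qed.

Let dyad_gt0 : 0 < dyad. Proof. exact: powR_gt0. Qed.

Definition tail_cst : R := 4 ^+ N / (1 - (2 `^ (2 * s))^-1).
Definition near_cst : R := 4 ^+ N * 2 `^ (2 * s) / (1 - 2 `^ (2 * s) / 4).

Lemma tail_cst_gt0 : 0 < tail_cst.
Proof.
by rewrite divr_gt0 ?exprn_gt0// subr_gt0 invf_lt1 ?dyad_gt0 ?dyad_gt1.
Qed.

Lemma near_cst_gt0 : 0 < near_cst.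
Proof.
rewrite divr_gt0 ?mulr_gt0 ?exprn_gt0 ?powR_gt0// subr_gt0.
by rewrite ltr_pdivrMr// mul1r dyad_lt4.
Qed.

(** On the annulus of radii [2 ^+ k * a] and [2 ^+ k.+1 * a] the kernel is at most its value at the
    inner radius; the contributions form a geometric series of ratio [dyad^-1]. *)
Lemma integral_kernel_tail (x : 'rV[R]_N) (a : R) : 0 < a ->
  (\int[lebesgue_rV R N]_(y in [set y | (a < enorm (x - y))%R])
     (fracker s x y)%:E <= (tail_cst * (a `^ (2 * s))^-1)%:E)%E.
Proof.
move=> a0.
apply: le_trans (integral_le_cover (x := x) (r := fun k => 2 ^+ k.+1 * a)
  (m := fun k => ((2 ^+ k * a) `^ (N%:R + 2 * s))^-1) _ _ _ _ _ _) _.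
- exact: measurable_enorm_gt.
- by apply: measurable_funTS; exact: measurable_fracker.
- by move=> y _; exact: fracker_ge0.
- by move=> k; rewrite mulr_ge0 ?exprn_ge0// ltW.
- by move=> k; rewrite invr_ge0 powR_ge0.
- move=> y /= ay; have /exists_dyadic [k /andP[k1 k2]] : 1 <= enorm (x - y) / a.
    by rewrite ler_pdivlMr// mul1r ltW.
  exists k; split; first by rewrite -ler_pdivrMr// ltW.
  rewrite /fracker lef_pV2 ?posrE ?powR_gt0 ?mulr_gt0 ?exprn_gt0//; last first.
    exact: lt_trans ay.
  rewrite ge0_ler_powR ?nnegrE ?enorm_ge0 ?mulr_ge0 ?exprn_ge0 ?(ltW a0)//.
    by rewrite addr_ge0// mulr_ge0// ltW.
  by rewrite -ler_pdivlMr.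
rewrite (eq_eseriesr (g := fun k => (4 ^+ N * (a `^ (2 * s))^-1 * dyad^-1 ^+ k)%:E)).
  rewrite nneseries_geometric ?invr_ge0 ?powR_ge0//; last first.
    by rewrite invf_lt1 ?dyad_gt0 ?dyad_gt1.
  by rewrite lee_fin /tail_cst mulrAC.
move=> k _; congr EFin.
rewrite (_ : 2 * (2 ^+ k.+1 * a) = 4 * (2 ^+ k * a)); last by rewrite exprS; ring.
rewrite kernel_cube ?mulr_gt0 ?exprn_gt0// powRM ?exprn_ge0 ?(ltW a0)//.
by rewrite powRXn// invfM exprVn; ring.
Qed.

(** On the annulus of radii [a / 2 ^+ k.+1] and [a / 2 ^+ k] the quadratic factor gains [4 ^- k]
    while the kernel costs [dyad ^+ k], whence a geometric series of ratio [dyad / 4]. *)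
Lemma integral_kernel_near (x : 'rV[R]_N) (a : R) : 0 < a ->
  (\int[lebesgue_rV R N]_(y in [set y | (0 < enorm (x - y) <= a)%R])
     ((enorm (x - y) / a) ^+ 2 * fracker s x y)%:E <=
   (near_cst * (a `^ (2 * s))^-1)%:E)%E.
Proof.
move=> a0.
apply: le_trans (integral_le_cover (x := x) (r := fun k => a / 2 ^+ k)
  (m := fun k => (2 ^+ k)^-1 ^+ 2 *
    ((a / 2 ^+ k.+1) `^ (N%:R + 2 * s))^-1) _ _ _ _ _ _) _.
- rewrite (_ : mkset _ = [set y | 0 < enorm (x - y)] `&`
      [set y | enorm (x - y) <= a]).
    apply: measurableI; [exact: measurable_enorm_gt|exact: measurable_enorm_le].
  by apply/seteqP; split => y /= /andP.
- apply: measurable_funTS; apply: measurable_funM; last exact: measurable_fracker.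
  apply: measurable_funX; apply: measurable_funM => //.
  exact: measurable_enormB.
- by move=> y _; rewrite mulr_ge0 ?fracker_ge0// sqr_ge0.
- by move=> k; rewrite divr_ge0 ?exprn_ge0// ltW.
- by move=> k; rewrite mulr_ge0 ?sqr_ge0// invr_ge0 powR_ge0.
- move=> y /= /andP[y0 ya].
  have /exists_dyadic [k /andP[k1 k2]] : 1 <= a / enorm (x - y).
    by rewrite ler_pdivlMr// mul1r.
  exists k; split; first by rewrite ler_pdivlMr ?exprn_gt0// mulrC -ler_pdivlMr.
  apply: ler_pM; rewrite ?sqr_ge0 ?fracker_ge0//.
    rewrite ler_sqr ?nnegrE ?divr_ge0 ?enorm_ge0 ?(ltW a0)//.
    by rewrite -(invf_div a) lef_pV2 ?posrE ?exprn_gt0// divr_gt0.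
  rewrite /fracker lef_pV2 ?posrE ?powR_gt0 ?divr_gt0 ?exprn_gt0//.
  rewrite ge0_ler_powR ?nnegrE ?enorm_ge0 ?divr_ge0 ?exprn_ge0 ?(ltW a0)//.
    by rewrite addr_ge0// mulr_ge0// ltW.
  by rewrite ler_pdivrMr ?exprn_gt0// mulrC -ler_pdivrMr// ltW.
rewrite (eq_eseriesr (g := fun k =>
  (4 ^+ N * dyad * (a `^ (2 * s))^-1 * (dyad / 4) ^+ k)%:E)).
  rewrite nneseries_geometric ?divr_ge0 ?powR_ge0//; last first.
    by rewrite ltr_pdivrMr// mul1r dyad_lt4.
  by rewrite lee_fin /near_cst mulrAC.
move=> k _; congr EFin.
have k0 : (2 ^+ k : R) != 0 by rewrite expf_neq0.
rewrite (_ : 2 * (a / 2 ^+ k) = 4 * (a / 2 ^+ k.+1)); last by rewrite exprS; field.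
rewrite -[LHS]mulrA kernel_cube ?divr_gt0 ?exprn_gt0//.
have -> : (a / 2 ^+ k.+1) `^ (2 * s) = a `^ (2 * s) / dyad ^+ k.+1.
  rewrite powRM ?invr_ge0 ?exprn_ge0 ?(ltW a0)//.
  rewrite -(powR_inv1 (exprn_ge0 _ _))// powRAC powRXn//.
  by rewrite powR_inv1 ?exprn_ge0 ?powR_ge0.
have d0 : dyad != 0 by rewrite gt_eqF ?dyad_gt0.
have p0 : a `^ (2 * s) != 0 by rewrite gt_eqF// powR_gt0.
have dk : dyad ^+ k != 0 by rewrite expf_neq0.
have E4 : 4 ^+ k = (2 ^+ k) ^+ 2 :> R by rewrite exprAC; congr (_ ^+ k); ring.
rewrite expr_div_n E4 [dyad ^+ k.+1]exprS.
by field; rewrite k0 d0 p0 dk.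
Qed.

End kernel_bounds.

(** * Integrals against the kernel outside a small ball *)

Section truncated_bound.
Context {R : realType} (N : nat) (s : R).
Hypotheses (s0 : 0 < s) (s1 : s < 1).
Implicit Types (x y q : 'rV[R]_N) (a e : R).

Local Notation D x e := [set y | (e < enorm (x - y))%R].

(** The second-order part of a cap of width [a], seen from the contact point [x] and capped at 1 far
    away. *)
Definition profile x a y : R := Num.min ((enorm (x - y) / a) ^+ 2) 1.

Lemma profile_ge0 x a y : 0 <= profile x a y.
Proof. by rewrite le_min sqr_ge0 ler01. Qed.

Lemma measurable_profile x a : measurable_fun setT (profile x a).
Proof.
apply: measurable_minr => //; apply: measurable_funX; apply: measurable_funM => //.
exact: measurable_enormB.
Qed.

(** Split at distance [a]: the quadratic branch is handled by the near bound, the constant branch by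
    the tail bound. The result does not depend on [e], so it survives the limit. *)
Lemma integral_profile_kernel x a e : 0 < a -> 0 < e ->
  (\int[lebesgue_rV R N]_(y in D x e) (profile x a y * fracker s x y)%:E <=
    ((near_cst N s + tail_cst N s) * (a `^ (2 * s))^-1)%:E)%E.
Proof.
move=> a0 e0; pose A := [set y | 0 < enorm (x - y) <= a].
have mDa := measurable_enorm_gt x a.
have mA : measurable A.
  rewrite (_ : A = D x 0 `&` [set y | enorm (x - y) <= a]).
    apply: measurableI; [exact: measurable_enorm_gt|exact: measurable_enorm_le].
  by apply/seteqP; split => y /= /andP.
have mpk : measurable_fun setT (fun y => (profile x a y * fracker s x y)%:E).
  apply/measurable_EFinP/measurable_funM; first exact: measurable_profile.
  exact: measurable_fracker.
have pk0 y : (0 <= (profile x a y * fracker s x y)%:E)%E.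
  by rewrite lee_fin mulr_ge0 ?profile_ge0 ?fracker_ge0.
apply: (@le_trans _ _ (\int[lebesgue_rV R N]_(y in A `|` D x a)
  (profile x a y * fracker s x y)%:E)%E).
  apply: ge0_subset_integral => //; first exact: measurable_enorm_gt.
  - exact: measurableU.
  - exact: measurable_funTS.
  - move=> y /= ey; have [ya|ya] := leP (enorm (x - y)) a; last by right.
    by left; rewrite /A/= ya (lt_trans e0 ey).
rewrite ge0_integral_setU//; last 2 first.
- exact: measurable_funTS.
- rewrite disj_set2E; apply/eqP/seteqP; split => // y [] /= /andP[_ ya].
  by rewrite ltNge ya.
rewrite mulrDl EFinD leeD//.
  rewrite (eq_integral (fun y => ((enorm (x - y) / a) ^+ 2 * fracker s x y)%:E)).
    exact: integral_kernel_near.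
  move=> y; rewrite inE => /andP[_ ya]; congr (_ * _)%:E; apply/min_idPl.
  by rewrite expr_le1// ?ler_pdivrMr ?mul1r// divr_ge0 ?enorm_ge0// ltW.
rewrite (eq_integral (fun y => (fracker s x y)%:E)).
  exact: integral_kernel_tail.
move=> y; rewrite inE => /= ya; rewrite -[X in _ = X%:E]mul1r; congr (_ * _)%:E.
apply/min_idPr; rewrite exprn_ege1// ler_pdivlMr// mul1r ltW//.
Qed.

Lemma integrable_mul_kernel (g : 'rV[R]_N -> R) x e M : 0 < e ->
  measurable_fun setT g -> (forall y, `|g y| <= M) ->
  (lebesgue_rV R N).-integrable (D x e) (EFin \o (fun y => g y * fracker s x y)).
Proof.
move=> e0 mg gM; have mD := measurable_enorm_gt x e.
have mk := measurable_fracker s x.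
have M0 : 0 <= M by apply: le_trans (gM 0).
have ik : (lebesgue_rV R N).-integrable (D x e) (EFin \o fracker s x).
  apply/integrableP; split; first exact/measurable_EFinP/measurable_funTS.
  rewrite (eq_integral (fun y => (fracker s x y)%:E)) => [|y _]; last first.
    by rewrite /= ger0_norm// fracker_ge0.
  by apply: le_lt_trans (integral_kernel_tail s0 x e0) _; rewrite ltry.
apply: (le_integrable mD _ _ (integrableZl mD M ik)).
  by apply/measurable_EFinP/measurable_funTS/measurable_funM.
move=> y _ /=; rewrite lee_fin normrM [leRHS]ger0_norm ?mulr_ge0 ?fracker_ge0//.
by rewrite [`|fracker _ _ _|]ger0_norm ?fracker_ge0// ler_wpM2r ?fracker_ge0.
Qed.

(** When [e < |x - y|], one has [1 + |y| <= c |x - y|] with [c = (1 + |x|) / e + 1], so the kernel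
    is at most [c ^ (N + 2s)] times the weight of the integrability condition. *)
Lemma integrable_sol_kernel (v : 'rV[R]_N -> R) x e : 0 < e ->
  (lebesgue_rV R N).-integrable setT
    (fun y => (v y * (1 + enorm y) `^ (- (N%:R + 2 * s)))%:E) ->
  (lebesgue_rV R N).-integrable (D x e) (EFin \o (fun y => v y * fracker s x y)).
Proof.
move=> e0 iv; have mD := measurable_enorm_gt x e.
pose al : R := N%:R + 2 * s.
have al0 : 0 <= al by rewrite addr_ge0// mulr_ge0// ltW.
pose c := (1 + enorm x) / e + 1.
have w0 y : 0 < 1 + enorm y by rewrite ltr_pwDl ?enorm_ge0.
have ivD := integrableS measurableT mD (@subsetT _ _) iv.
apply: (le_integrable mD _ _ (integrableZl mD (c `^ al) ivD)).
  apply/measurable_EFinP/measurable_funTS.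
  (* Measurability is inherited from the weighted function by dividing out the positive weight. *)
  rewrite (_ : (fun y => _) = (fun y =>
      v y * (1 + enorm y) `^ (- al) * ((1 + enorm y) `^ al * fracker s x y))).
    apply: measurable_funM; first by apply/measurable_EFinP; exact: (measurable_int _ iv).
    apply: measurable_funM; last exact: measurable_fracker.
    apply: (measurableT_comp (measurable_powR _)).
    by apply: measurable_funD => //; exact: measurable_enorm.
  apply/funext => y; rewrite powRN; field.
  by rewrite gt_eqF// powR_gt0.
move=> y /= ey; rewrite lee_fin mulrCA !normrM ler_wpM2l//.
rewrite !ger0_norm ?fracker_ge0 ?mulr_ge0 ?powR_ge0// -/al.
rewrite powRN ler_pdivlMr ?powR_gt0// /fracker mulrC ler_pdivrMr; last first.
  by rewrite powR_gt0// (lt_trans e0 ey).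
have c0 : 0 < c by rewrite ltr_wpDl// divr_ge0 ?(ltW e0)// ltW.
rewrite -powRM ?enorm_ge0 ?(ltW c0)//.
rewrite ge0_ler_powR ?nnegrE ?mulr_ge0 ?enorm_ge0 ?(ltW c0) ?(ltW (w0 _))//.
have h1 : 1 + enorm x <= (1 + enorm x) / e * enorm (x - y).
  by rewrite mulrAC ler_pdivlMr// ler_pM2l// ltW.
have := lerB_enormB y x; rewrite (enormBC y x) /c; lra.
Qed.

(** The point reflection [T] through [x] preserves the measure, the domain and the kernel, and
    changes the sign of the linear factor; the integral thus equals its opposite. *)
Lemma Rintegral_odd_kernel x q a e : 0 < e ->
  \int[lebesgue_rV R N]_(y in D x e)
    (\1_[set y | enorm (x - y) <= a] y * dotr q (y - x) * fracker s x y) = 0.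
Proof.
move=> e0; pose g y := \1_[set y | enorm (x - y) <= a] y * dotr q (y - x).
pose F y := g y * fracker s x y.
rewrite [LHS](_ : _ = \int[lebesgue_rV R N]_(y in D x e) F y)//.
have mg : measurable_fun setT g.
  apply: measurable_funM; last exact: measurable_dotrB.
  by apply: measurable_indic; exact: measurable_enorm_le.
have gM y : `|g y| <= enorm q * `|a|.
  rewrite /g indicE normrM; case: (boolP (_ \in _)) => [|_]; last first.
    by rewrite normr0 mul0r mulr_ge0 ?enorm_ge0.
  rewrite inE/= normr1 mul1r => ya.
  rewrite (le_trans (abs_dotr_le_enorm _ _))// ler_wpM2l ?enorm_ge0//.
  by rewrite enormBC (le_trans ya)// ler_norm.
have iF : (lebesgue_rV R N).-integrable (D x e) (EFin \o F).
  exact: integrable_mul_kernel gM.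
pose T y := x + x - y.
have mT : measurable_fun setT T.
  rewrite (_ : T = fun y => x + x + (-1) *: y); first exact: measurable_rV_affine.
  by apply/funext => y; rewrite scaleN1r.
have xT y : x - T y = y - x by rewrite /T; apply/rowP => i; rewrite !mxE; ring.
have FT y : F (T y) = - F y.
  rewrite /F /g /fracker !indicE xT (enormBC y x).
  rewrite (_ : (T y \in _) = (y \in [set z | enorm (x - z) <= a])); last first.
    by apply/idP/idP; rewrite !inE/= xT enormBC.
  rewrite (_ : T y - x = - (y - x)); last by rewrite -(xT y) opprB.
  by rewrite dotrC dotrN (dotrC q); ring.
have DT : T @^-1` D x e = D x e.
  by apply/seteqP; split => y /=; rewrite xT enormBC.
have mF : measurable_fun setT (EFin \o F).
  by apply/measurable_EFinP/measurable_funM => //; exact: measurable_fracker.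
have iNF : (lebesgue_rV R N).-integrable (T @^-1` D x e) ((EFin \o F) \o T).
  rewrite DT (_ : _ \o T = -%E \o (EFin \o F)); first exact: integrableN.
  by apply/funext => y /=; rewrite FT.
have mD := measurable_enorm_gt x e.
have : \int[lebesgue_rV R N]_(y in D x e) F y =
    - \int[lebesgue_rV R N]_(y in D x e) F y.
  rewrite -[RHS]mulN1r -RintegralZl//; congr fine.
  transitivity (\int[pushforward (lebesgue_rV R N) T]_(y in D x e) (F y)%:E)%E.
    by apply: eq_measure_integral => A mA _; apply/esym/lebesgue_rV_reflect.
  rewrite (integral_pushforward mT mF iNF mD) DT.
  by apply: eq_integral => y _ /=; rewrite FT mulN1r.
lra.
Qed.

End truncated_bound.

(** * Touching from below *)

Section touching.
Context {R : realType} (N : nat) (s : R).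
Hypotheses (s0 : 0 < s) (s1 : s < 1).
Implicit Types (x y z q : 'rV[R]_N) (a e : R).

Local Notation D x e := [set y | (e < enorm (x - y))%R].

(* Upper bound, up to the factor t, for the decrease from the contact point x
   of a function touched from below by a cap. *)
Definition tangent x q a y : R :=
  \1_[set y | enorm (x - y) <= a] y * dotr q (y - x) + profile x a y.

(** Integrate the pointwise bound against the kernel: the linear part of [tangent] vanishes by
    oddness, the profile costs a multiple of [a ^ (-2s)], and on [B] the kernel is at least [b]. *)
Lemma fracLap_trunc_le (v : 'rV[R]_N -> R) x q a e (t A b : R) (B : set 'rV[R]_N) :
  (0 < N)%N -> 0 < a -> 0 < e -> 0 <= t -> 0 <= A -> 0 < b ->
  (lebesgue_rV R N).-integrable setT
    (fun y => (v y * (1 + enorm y) `^ (- (N%:R + 2 * s)))%:E) ->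
  measurable B -> B `<=` D x e -> (forall y, B y -> b <= fracker s x y) ->
  (forall y, y != 0 -> v x - v y <= t * tangent x q a y - A * \1_B y) ->
  fracLap_trunc s v x e <=
    t * ((near_cst N s + tail_cst N s) * (a `^ (2 * s))^-1) -
    A * b * fine (lebesgue_rV R N B).
Proof.
move=> N0 a0 e0 t0 A0 b0 iv mB BD bK vle.
set mu := lebesgue_rV R N; have mD := measurable_enorm_gt x e.
pose f y := (v x - v y) * fracker s x y.
pose F y := \1_[set y | enorm (x - y) <= a] y * dotr q (y - x) * fracker s x y.
pose P y := profile x a y * fracker s x y.
have iF : mu.-integrable (D x e) (EFin \o F).
  apply: (@integrable_mul_kernel _ _ _ _ _ _ _ (enorm q * a)) => //.
    apply: measurable_funM; last exact: measurable_dotrB.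
    by apply: measurable_indic; exact: measurable_enorm_le.
  move=> y; rewrite indicE normrM; case: (boolP (_ \in _)) => [|_]; last first.
    by rewrite normr0 mul0r mulr_ge0 ?enorm_ge0// ltW.
  rewrite inE/= normr1 mul1r => ya.
  rewrite (le_trans (abs_dotr_le_enorm _ _))// ler_wpM2l ?enorm_ge0//.
  by rewrite enormBC.
have iP : mu.-integrable (D x e) (EFin \o P).
  apply: (@integrable_mul_kernel _ _ _ _ _ _ _ 1) => //.
    exact: measurable_profile.
  by move=> y; rewrite ger0_norm ?profile_ge0// ge_min lexx orbT.
(* [b * \1_B] is dominated by the kernel, which is integrable on [D x e]; this also makes the
   measure of [B] finite. *)
have ib : mu.-integrable (D x e) (EFin \o (fun y => b * \1_B y)).
  have iK := integrable_mul_kernel (g := cst 1) (M := 1) s0 x e0.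
  apply: (le_integrable mD _ _ (iK _ _)) => //.
  - by apply/measurable_EFinP; apply: measurable_funM => //; exact: measurable_indic.
  - move=> y _ /=; rewrite lee_fin mul1r !ger0_norm ?mulr_ge0 ?fracker_ge0 ?(ltW b0)//.
    rewrite indicE; have [yB|yB] := pselect (B y).
      by rewrite mem_set// mulr1 bK.
    by rewrite memNset// mulr0 fracker_ge0.
  - by move=> y /=; rewrite normr1.
have if_ : mu.-integrable (D x e) (EFin \o f).
  rewrite (_ : EFin \o f = (EFin \o (fun y => v x * fracker s x y)%R) \-
      (EFin \o (fun y => v y * fracker s x y)%R))%E; last first.
    by apply/funext => y; rewrite /= /f (mulrBl (fracker s x y)) EFinB.
  apply: integrableB => //; last exact: integrable_sol_kernel.
  by apply: (@integrable_mul_kernel _ _ _ _ (cst (v x)) _ _ `|v x|).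
pose G y := t * (F y + P y) - A * (b * \1_B y).
have iFP : mu.-integrable (D x e) (EFin \o (fun y => F y + P y)).
  by rewrite (_ : _ \o _ = (EFin \o F) \+ (EFin \o P))%E//; exact: integrableD.
have itFP : mu.-integrable (D x e) (EFin \o (fun y => t * (F y + P y))).
  exact: (integrableZl mD t iFP).
have iAb : mu.-integrable (D x e) (EFin \o (fun y => A * (b * \1_B y))).
  exact: (integrableZl mD A ib).
have iG : mu.-integrable (D x e) (EFin \o G).
  rewrite (_ : _ \o _ = (EFin \o (fun y => t * (F y + P y))%R) \-
    (EFin \o (fun y => A * (b * \1_B y))%R))%E//.
  exact: integrableB.
(* The pointwise bound is assumed away from the origin only, hence the removal of this null set. *)
have [m1 mu1] := lebesgue_rV_set1 (0 : 'rV[R]_N) N0.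
have mD0 : measurable (D x e `\` [set 0]) by exact: measurableD.
have fG : \int[mu]_(y in D x e) f y <= \int[mu]_(y in D x e) G y.
  rewrite /Rintegral (negligible_integral m1 mD if_ mu1).
  rewrite (negligible_integral m1 mD iG mu1).
  apply: le_Rintegral => //.
  - exact: integrableS if_.
  - exact: integrableS iG.
  move=> y [_ /= /eqP y0]; apply: le_trans (ler_wpM2r (fracker_ge0 s x y) (vle y y0)) _.
  rewrite /G /F /P /tangent (_ : forall i d w k : R, (t * (i + d) - A * w) * k =
    t * (i * k + d * k) - A * (w * k)) ?lerD2l ?lerN2; last by move=> *; ring.
  rewrite ler_wpM2l// indicE.
  have [yB|yB] := pselect (B y); last by rewrite memNset// mulr0 mul0r.
  by rewrite mem_set// mulr1 mul1r bK.
rewrite [leLHS](_ : _ = \int[mu]_(y in D x e) f y)//.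
apply: (le_trans fG); rewrite RintegralB//.
rewrite [X in X - _]RintegralZl// [X in _ - X]RintegralZl//.
rewrite RintegralD// Rintegral_odd_kernel// add0r.
have -> : \int[mu]_(y in D x e) (b * \1_B y) = b * fine (mu B).
  have iB : mu.-integrable (D x e) (EFin \o \1_B).
    rewrite (_ : _ \o _ = (fun y => (b^-1)%:E * (EFin \o (fun y => b * \1_B y)%R) y))%E.
      exact: integrableZl.
    by apply/funext => y /=; rewrite -EFinM mulKf// gt_eqF.
  rewrite RintegralZl// /Rintegral integral_indic//; congr (_ * fine (mu _)).
  exact/setIidPl.
rewrite mulrA lerD2r ler_wpM2l//.
rewrite -lee_fin fineK; last first.
  exact: integrable_fin_num.
exact: integral_profile_kernel.
Qed.

(** Minimize [v - t * phi] over the closed ball, which avoids the origin. The minimum is negative,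
    while outside the ball [phi < 0 <= v]; the comparison at the minimum point therefore holds on
    the whole punctured space. *)
Lemma cap_touching (v : 'rV[R]_N -> R) z a (t : R) :
  0 < a -> a < enorm z -> (forall y, y != 0 -> 0 <= v y) ->
  (forall y, enorm (y - z) <= a -> {for y, continuous v}) -> v z < t ->
  exists x, [/\ enorm (x - z) < a, v x < t &
    exists q, forall y, y != 0 -> v x - v y <= t * tangent x q a y].
Proof.
move=> a0 az v0 cv vt; pose phi y : R := 1 - (enorm (y - z) / a) ^+ 2.
have z0 : z != 0 by rewrite -enorm_gt0 (lt_trans a0).
have t0 : 0 < t by apply: le_lt_trans vt; exact: v0.
pose A := [set y | enorm (y - z) <= a].
have Az : A z by rewrite /A/= subrr enorm0 ltW.
have A0 y : A y -> y != 0.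
  move=> Ay; apply/eqP => y0; move: Ay; rewrite /A/= y0 sub0r enormN.
  by rewrite leNgt az.
have cu : {within A, continuous (fun y => v y - t * phi y)}.
  apply: continuous_in_subspaceT => y; rewrite inE => Ay.
  have c1 : {for y, continuous (fun y : 'rV[R]_N => enorm (y - z))}.
    apply: (continuous_comp (f := fun y : 'rV[R]_N => y - z) (g := @enorm R N)).
      by apply: continuousB => //; exact: cst_continuous.
    exact: enorm_continuous.
  have c2 := continuousM c1 (@cst_continuous _ _ a^-1 y).
  have c3 := continuous_comp c2 (@exprn_continuous _ 2 _).
  have c4 := continuousB (@cst_continuous _ _ (1 : R) y) c3.
  have c5 := continuousM (@cst_continuous _ _ t y) c4.
  exact: (continuousB (cv y Ay) c5).
have [x] := EVT_min_rV (ex_intro _ z Az) (@closed_eball_compact R N z a) cu.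
rewrite inE => Ax xmin.
have phi1 y : phi y <= 1 by rewrite lerBlDr lerDl sqr_ge0.
have phiz : phi z = 1 by rewrite /phi subrr enorm0 mul0r expr0n subr0.
(* The centre already gives the negative value [v z - t]. As [v x] is nonnegative, [phi x > 0], so
   [x] is in the open ball. *)
have ux : v x - t * phi x < 0.
  apply: le_lt_trans (xmin z _) _; first by rewrite inE.
  by rewrite phiz mulr1 subr_lt0.
have vx0 : 0 <= v x by apply/v0/A0.
have phix : 0 < phi x by rewrite -(pmulr_rgt0 _ t0); lra.
have tphix : t * phi x <= t by rewrite ger_pMr.
exists x; split.
- have : enorm (x - z) / a < 1.
    rewrite -(@expr_lt1 _ 2) ?divr_ge0 ?enorm_ge0 ?(ltW a0)//.
    by move: phix; rewrite /phi subr_gt0.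
  by rewrite ltr_pdivrMr// mul1r.
- lra.
(* The slope is minus the gradient of [phi] at [x]; since [phi] is quadratic, its expansion there is
   exact. *)
exists ((2 / a ^+ 2) *: (x - z)) => y y0.
have vy0 := v0 y y0.
have phiE : phi x - phi y =
    dotr ((2 / a ^+ 2) *: (x - z)) (y - x) + (enorm (x - y) / a) ^+ 2.
  rewrite /phi !expr_div_n dotrZ (enormBC x y).
  have := sqr_enormD (x - z) (y - x).
  rewrite (_ : x - z + (y - x) = y - z) => [->|].
    by field; rewrite gt_eqF.
  by apply/rowP => i; rewrite !mxE; ring.
have le1 : v x - v y <= t * (phi x - phi y).
  have [ya|ya] := leP (enorm (y - z)) a.
    by have := xmin y; rewrite inE => /(_ ya); lra.
  have : phi y < 0.
    by rewrite /phi subr_lt0 exprn_egt1// ltr_pdivlMr// mul1r.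
  by rewrite -(pmulr_rlt0 _ t0); lra.
rewrite /tangent /profile indicE; have [xy|xy] := leP (enorm (x - y)) a.
  rewrite mem_set// mul1r (min_idPl _) -?phiE//.
  by rewrite expr_le1// ?ler_pdivrMr ?mul1r// divr_ge0 ?enorm_ge0// ltW.
(* Beyond distance [a] from [x] the bound reduces to [t], and [v x < t] suffices. *)
rewrite memNset/= ?leNgt ?xy// mul0r add0r (min_idPr _) ?mulr1; first lra.
by rewrite exprn_ege1// ler_pdivlMr// mul1r ltW.
Qed.

End touching.
(** * Estimates for solutions *)

Lemma fracLap_cst_ge0 (R : realType) (N : nat) (s : R) :
  0 <= s -> 0 <= fracLap_cst N s.
Proof.
move=> s0; have gamma_ge0 z : 0 <= gamma_fun z :> R.
  by apply: Rintegral_ge0 => t _; rewrite mulr_ge0 ?powR_ge0 ?expR_ge0.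
by rewrite divr_ge0 ?mulr_ge0 ?powR_ge0.
Qed.

Section estimates.
Context {R : realType} (N : nat) (s p : R) (v : 'rV[R]_N -> R).
Hypotheses (N0 : (0 < N)%N) (s0 : 0 < s) (s1 : s < 1) (p1 : 1 < p).
Hypotheses (vs : is_solution s p v)
  (vp : forall x, punctured_eball 1 x -> 0 < v x).
Implicit Types (x y z : 'rV[R]_N) (a t A b r : R).

Local Notation bound a := ((near_cst N s + tail_cst N s) * (a `^ (2 * s))^-1).

Let v_ge0 y : y != 0 -> 0 <= v y.
Proof.
move=> y0; have [y1|y1] := ltP (enorm y) 1; first by apply/ltW/vp.
by rewrite (sol_ext vs)// /eball/= ltNge y1.
Qed.

Lemma sol_touching z a t A b (B : set 'rV[R]_N) :
  0 < a -> a < enorm z -> enorm z + a < 1 -> v z < t -> 0 <= A -> 0 < b ->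
  measurable B -> (forall y, B y -> y != 0 -> A <= v y) ->
  (forall x y, enorm (x - z) < a -> B y ->
    a < enorm (x - y) /\ b <= fracker s x y) ->
  exists x, [/\ enorm (x - z) < a, punctured_eball 1 x &
    v x `^ p <=
      fracLap_cst N s * (t * bound a - A * b * fine (lebesgue_rV R N B))].
Proof.
move=> a0 az za vt A0 b0 mB AB BK.
have ball y : enorm (y - z) <= a -> punctured_eball 1 y.
  move=> ya; have := lerB_enormB y z; have := lerB_enormB z y.
  rewrite (enormBC z y) => h1 h2; split; first by rewrite /eball/=; lra.
  by rewrite -enorm_gt0; lra.
have [y /ball yz|x [xa xt [q xq]]] := cap_touching a0 az v_ge0 _ vt.
  exact: (sol_C2 vs).1.
have x1 := ball x (ltW xa).
exists x; split=> //.
have -> : v x `^ p = fracLap s v x by apply/esym/subr0_eq/(sol_eq vs).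
rewrite ler_wpM2l ?fracLap_cst_ge0 ?(ltW s0)//.
(* The bound on the truncated integrals is uniform in [e <= a], so it passes to the limit. *)
apply: limr_le; first exact: (sol_cvg vs).
near=> e; have e0 : 0 < e by [].
have ea : e <= a by near: e; apply: nbhs_right_le.
have t0 : 0 <= t by apply/ltW/(le_lt_trans _ xt)/v_ge0; case: x1.
apply: (fracLap_trunc_le (q := q) s0 s1) => //.
- exact: (sol_L1 vs).
- by move=> y /(BK x y xa)[+ _]; exact: le_lt_trans.
- by move=> y /(BK x y xa)[].
move=> y y0; have [yB|yB] := pselect (B y); last first.
  by rewrite indicE memNset// mulr0 subr0 xq.
have [xy _] := BK x y xa yB.
rewrite indicE mem_set// mulr1 /tangent indicE memNset/= ?leNgt ?xy//.
rewrite mul0r add0r /profile (min_idPr _) ?mulr1.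
  by have := AB y yB y0; lra.
by rewrite exprn_ege1// ler_pdivlMr// mul1r ltW.
Unshelve. all: by end_near. Qed.

Hypothesis vd : radially_decreasing v.

(** A contact point within [|x| / 4] of [(3 / 4) *: x] has norm less than [|x|], so [v] is at least
    [v x] there. *)
Lemma interior_lower_bound x : punctured_eball (1 / 2) x ->
  v x `^ p <= fracLap_cst N s *
    (2 * v ((3 / 4) *: x) * bound (enorm x / 4)).
Proof.
move=> [/= x2 x0]; set w := (3 / 4) *: x.
move: x2; rewrite /eball/= => x2; have := x0; rewrite -enorm_gt0 => r0.
have wE : enorm w = 3 / 4 * enorm x by rewrite enormZ ger0_norm.
have w0 : w != 0 by rewrite -enorm_gt0 wE; lra.
have vw : 0 < v w by apply: vp; split => //; rewrite /eball/= wE; lra.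
(* Here [2 * v w] serves as a height exceeding [v w], and the gain is switched off by [A = 0] and an
   empty [B]. *)
have [||||||//|//|//|y [ya y1 yp]] := @sol_touching w (enorm x / 4) (2 * v w) 0 1 set0.
- lra.
- by rewrite wE; lra.
- by rewrite wE; lra.
- lra.
- by [].
- by [].
move: yp; rewrite mul0r mul0r subr0; apply: le_trans.
apply: ge0_ler_powR; rewrite ?nnegrE ?v_ge0//.
- exact: ltW (lt_trans ltr01 p1).
- by case: y1.
have [yx|yx] := eqVneq (enorm y) (enorm x); first by rewrite (vd.1 y x)//; case: y1.
apply: vd.2; first by case: y1.
by have := lerB_enormB y w; rewrite lt_neqAle yx wE/=; lra.
Qed.

(** A cap centred at [x] has its contact point at distance between [|x| / 4] and [2 |x|] from the
    ball of radius [|x| / 8] about 0, where [v >= v w]. A large [v w] would make the right-hand side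
    of the equation bound negative. *)
Lemma doubling x : punctured_eball (1 / 2) x ->
  v ((3 / 4) *: x) * (((8 * N%:R) ^+ N)^-1 * ((2 * enorm x) `^ (2 * s))^-1) <=
    2 * v x * bound (enorm x / 4).
Proof.
move=> [/= x2 x0]; set w := (3 / 4) *: x; set r := enorm x.
move: x2; rewrite /eball/= -/r => x2; have := x0; rewrite -enorm_gt0 -/r => r0.
have wE : enorm w = 3 / 4 * r by rewrite enormZ ger0_norm.
have w0 : w != 0 by rewrite -enorm_gt0 wE; lra.
have vx : 0 < v x by apply: vp; split => //; rewrite /eball/= -/r; lra.
have n0 : 0 < N%:R :> R by rewrite ltr0n.
(* Chosen so that the ball of radius [N * h = r / 8] contains a cube of half side [h], which bounds
   its volume below. *)
pose h := r / (8 * N%:R).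
have h0 : 0 < h by rewrite divr_gt0// mulr_gt0.
have Nh : N%:R * h = r / 8 by rewrite /h; field; rewrite gt_eqF.
pose B : set 'rV[R]_N := [set y | enorm (0 - y) <= N%:R * h].
have mB : measurable B by exact: measurable_enorm_le.
pose b : R := ((2 * r) `^ (N%:R + 2 * s))^-1.
have b0 : 0 < b by rewrite invr_gt0 powR_gt0; lra.
have [||||||//|||y [ya y1 yp]] := @sol_touching x (r / 4) (2 * v x) (v w) b B.
- lra.
- by rewrite -/r; lra.
- by rewrite -/r; lra.
- lra.
- exact: v_ge0.
- by [].
- move=> y; rewrite /B/= sub0r enormN Nh => yr y0; apply: vd.2 => //.
  by rewrite wE; lra.
- move=> z y zx; rewrite /B/= sub0r enormN Nh => yr.
  have := lerB_enormB x z; have := lerB_enormB z x; have := ler_enormB z y.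
  have := lerB_enormB z y; rewrite (enormBC x z) -/r => h1 h2 h3 h4.
  split; first lra.
  rewrite lef_pV2 ?posrE ?powR_gt0//; [|lra|lra].
  apply: ge0_ler_powR; rewrite ?nnegrE ?enorm_ge0//; [|lra|lra].
  by rewrite addr_ge0// mulr_ge0// ltW.
have := vp y1; move=> /(powR_gt0 p)/lt_le_trans/(_ yp) => pos.
have {}pos : 0 <= 2 * v x * bound (r / 4) - v w * b * fine (lebesgue_rV R N B).
  rewrite leNgt; apply/negP => neg; move: pos.
  by rewrite ltNge mulr_ge0_le0// ?fracLap_cst_ge0// ltW.
apply: le_trans (_ : v w * b * fine (lebesgue_rV R N B) <= _); last lra.
rewrite -mulrA ler_wpM2l ?v_ge0//.
have fB : lebesgue_rV R N B \is a fin_num.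
  rewrite ge0_fin_numE//; apply: le_lt_trans (lebesgue_rV_enorm_le _ _) _.
    by rewrite Nh; lra.
  by rewrite ltry.
have hB : (2 * h) ^+ N <= fine (lebesgue_rV R N B).
  by rewrite -lee_fin fineK//; apply: lebesgue_rV_enorm_ge; exact: ltW.
apply: le_trans (ler_wpM2l (ltW b0) hB).
have r2 : 2 * r != 0 by rewrite gt_eqF//; lra.
rewrite /b powRD ?r2 ?implybT// powR_mulrn; last lra.
rewrite (_ : 2 * h = (2 * r) / (8 * N%:R)); last by rewrite /h mulrA.
rewrite expr_div_n le_eqVlt; apply/orP; left; apply/eqP.
have u0 : (2 * r) ^+ N != 0 by rewrite expf_neq0.
have u1 : (8 * N%:R) ^+ N != 0 :> R by rewrite expf_neq0// mulf_neq0// gt_eqF.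
have u2 : (2 * r) `^ (2 * s) != 0 by rewrite gt_eqF// powR_gt0; lra.
by field; rewrite u0 u1 u2.
Qed.

End estimates.

(** * Combination of the two estimates *)

Theorem proposition4p4 (R : realType) (N : nat) (s p : R) (hN : (0 < N)%N)
    (hs0 : 0 < s) (hs1 : s < 1) (hp : 1 < p) :
  exists c17 : R, 0 < c17 /\
    forall v : 'rV[R]_N -> R,
      is_solution s p v ->
      (forall x, punctured_eball 1 x -> 0 < v x) ->
      radially_decreasing v ->
      forall x, punctured_eball (1 / 2) x ->
        v x <= c17 * enorm x `^ (- (2 * s / (p - 1))).
Proof.
(* [C] and [k] are the scale-free factors of the two estimates, each to be divided by
   [W = |x| ^ (2s)]. *)
pose C := (near_cst N s + tail_cst N s) * ((4^-1) `^ (2 * s))^-1.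
pose k := ((8 * N%:R) ^+ N)^-1 * (2 `^ (2 * s))^-1 : R.
have C0 : 0 < C.
  apply: mulr_gt0; first by apply: addr_gt0; [exact: near_cst_gt0|exact: tail_cst_gt0].
  by rewrite invr_gt0; apply: powR_gt0; rewrite invr_gt0.
have k0 : 0 < k.
  by rewrite mulr_gt0// invr_gt0 ?exprn_gt0 ?mulr_gt0 ?ltr0n ?powR_gt0.
have c0 := fracLap_cst_ge0 N (ltW hs0).
(* The first term is what elimination of [v ((3 / 4) *: x)] produces; adding 1 ensures [0 < L]. *)
pose L := fracLap_cst N s * 4 * C ^+ 2 / k + 1.
have L0 : 0 < L.
  apply: ltr_pwDr => //; apply: divr_ge0; last exact: ltW.
  by rewrite mulr_ge0 ?sqr_ge0// mulr_ge0.
exists (L `^ (p - 1)^-1); split; first exact: powR_gt0.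
move=> v vs vp vd x xB.
have [x2 x0] := xB; move: x2; rewrite /eball/= => x2.
have := x0; rewrite -enorm_gt0 => r0.
have M0 : 0 < v x by apply: vp; split => //; rewrite /eball/=; lra.
have := interior_lower_bound hN hs0 hs1 hp vs vp vd xB.
have := doubling hN hs0 hs1 vs vp vd xB.
set A := v (_ *: x); set r := enorm x in r0 x2 *; set M := v x in M0 *.
pose W := r `^ (2 * s); have W0 : 0 < W by exact: powR_gt0.
rewrite !powRM ?invr_ge0 ?(ltW r0)// -/W.
have -> : (near_cst N s + tail_cst N s) * (W * 4^-1 `^ (2 * s))^-1 = C / W.
  by rewrite /C invfM mulrA mulrAC.
have -> : A * (((8 * N%:R) ^+ N)^-1 * (2 `^ (2 * s) * W)^-1) = A * k / W.
  by rewrite /k invfM !mulrA.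
rewrite [2 * M * _]mulrA ler_pM2r ?invr_gt0// => AM MA.
have MpL : M `^ (p - 1) <= L / W.
  rewrite -(ler_pM2l M0) mulr_powRB1//; [|exact: ltW|lra].
  apply: (le_trans MA).
  (* The factor [A * k] is isolated to be replaced by its bound [2 * M * C]; a factor [M] then
     cancels. *)
  rewrite (_ : _ * _ = fracLap_cst N s * 2 * C / k / W * (A * k)); last first.
    by field; rewrite (gt_eqF k0) (gt_eqF W0).
  apply: (@le_trans _ _ (fracLap_cst N s * 2 * C / k / W * (2 * M * C))).
    rewrite ler_wpM2l//; apply: divr_ge0; last exact: ltW.
    apply: divr_ge0; last exact: ltW.
    by apply: mulr_ge0; [rewrite mulr_ge0|exact: ltW].
  rewrite (_ : _ * _ = M * ((L - 1) / W)); last first.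
    by rewrite /L; field; rewrite (gt_eqF k0) (gt_eqF W0).
  by rewrite ler_pM2l// ler_pM2r ?invr_gt0//; lra.
have p10 : 0 < p - 1 by lra.
(* It remains to take the root of order [p - 1], which turns [W^-1] into the stated power of
   [|x|]. *)
have -> : M = (M `^ (p - 1)) `^ (p - 1)^-1.
  by rewrite -powRrM mulfV ?gt_eqF// powRr1// ltW.
have -> : r `^ (- (2 * s / (p - 1))) = W^-1 `^ (p - 1)^-1.
  by rewrite -powRN -powRrM mulNr.
rewrite -powRM ?invr_ge0 ?(ltW L0) ?(ltW W0)//.
apply: ge0_ler_powR => //; rewrite ?nnegrE ?invr_ge0 ?powR_ge0 ?(ltW p10)//.
by rewrite divr_ge0 ?ltW.
Qed.
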